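(* Let $n$ and $k$ be integers with $3\le k<n$. The average number of cycles of length $k$ in a triangulated $n$-gon (the average being over all triangulations of the $n$-gon) is $$\binom{2n-k-1}{n-1}\frac{C_{k-2}}{C_{n-2}}.$$
   Context: $C_m=\frac{1}{m+1}\binom{2m}{m}$ for $m\ge 0$ denotes the $m$-th Catalan number. Fix a convex $n$-gon with labelled (distinguishable) vertices. A triangulation of the $n$-gon is a partition of it into $n-2$ triangles by $n-3$ pairwise noncrossing diagonals; triangulations are distinct when their sets of diagonals differ (no identification under rotation or reflection). A triangulation is regarded as a simple graph on the $n$ vertices of the polygon whose edges are the $n$ sides of the polygon and the $n-3$ diagonals. A cycle of length $k$ is a cycle subgraph with $k$ vertices (unrooted and unoriented). The average is the uniform average over all triangulations of the $n$-gon. *)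

(* Defs.v *)
From mathcomp Require Import all_boot all_order all_algebra.

Set Implicit Arguments.
Unset Strict Implicit.
Unset Printing Implicit Defensive.

Import GRing.Theory Num.Theory.

(* The vertices of the convex n-gon are labelled by 'I_n in cyclic order. An
   edge is the set of its two end points. *)

Definition sides (n : nat) : {set {set 'I_n}} :=
  [set [set i; ordS i] | i : 'I_n].

Definition diagonals (n : nat) : {set {set 'I_n}} :=
  [set e : {set 'I_n} | (#|e| == 2) && (e \notin sides n)].

(* In a convex polygon, two diagonals meet in their interiors exactly when the
   end points b, d of one lie strictly on different sides of the other, ac;
   diagonals that only share an end point do not cross. *)
Definition crossing (n : nat) (e f : {set 'I_n}) : bool :=
  [exists a : 'I_n, exists c : 'I_n, exists b : 'I_n, exists d : 'I_n,
    [&& e == [set a; c], f == [set b; d], a < b < c & (d < a) || (c < d)]].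

(* A triangulation is identified with its set of diagonals: n - 3 pairwise
   noncrossing diagonals always cut the polygon into n - 2 triangles. *)
Definition triangulations (n : nat) : {set {set {set 'I_n}}} :=
  [set T : {set {set 'I_n}} |
    [&& T \subset diagonals n, #|T| == n - 3
      & [forall e in T, forall f in T, ~~ crossing e f]]].

Definition adj (n : nat) (T : {set {set 'I_n}}) : rel 'I_n :=
  [rel x y | [set x; y] \in sides n :|: T].

Definition cycle_edges (n : nat) (c : seq 'I_n) : {set {set 'I_n}} :=
  [set [set x; next c x] | x in c].

(* Cycle subgraphs are represented by their edge sets, so that the 2k rooted
   and oriented traversals c of a k-cycle (k >= 3) count only once. *)
Definition cycles (n : nat) (T : {set {set 'I_n}}) (k : nat) :
    {set {set {set 'I_n}}} :=
  [set cycle_edges c | c : k.-tuple 'I_n & ucycleb (adj T) c].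

Local Open Scope ring_scope.

Definition catalan (m : nat) : rat := 'C(2 * m, m)%:R / m.+1%:R.

Definition average_cycles (n k : nat) : rat :=
  (\sum_(T in triangulations n) #|cycles T k|%:R) / #|triangulations n|%:R.

(* Main.v *)
Require Import Defs.
From HB Require Import structures.
From mathcomp Require Import all_boot all_order all_algebra.
From mathcomp Require Import zify ring.

(* Triangulations of the (m+1)-gon with a distinguished root side correspond to
   binary trees with m leaves: a node is the triangle resting on the current
   root edge. A cycle of a triangulated polygon visits its vertices in their
   cyclic order, since its edges do not cross; hence it is determined by its
   vertex set, and either it lies in one of the two polygons cut off by the root
   triangle, or it consists of the root edge and one path in each of them.

   Let y = x + y^2 be the generating function of the trees, with coefficients
   c_m. The numbers of paths of length k joining the ends of the root edge then
   have generating function c_k y^k, hence the numbers of cycles of length k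
   have generating function c_(k-1) y^(k-1) / (1 - 2y). The coefficients of
   y^j / (1 - 2y) satisfy Pascal's recurrence, so they are the binomials
   'C(2m - j, m), and y = y / (1 - 2y) - 2 y^2 / (1 - 2y) gives the Catalan
   numbers. *)

Set Implicit Arguments.
Unset Strict Implicit.
Unset Printing Implicit Defensive.

Import GRing.Theory Num.Theory.

(** * Binary trees and generating series *)

Inductive tree := Leaf | Node of tree & tree.

Lemma tree_comparable : comparable tree.
Proof. by move=> t u; rewrite /decidable; decide equality. Qed.

HB.instance Definition _ := hasDecEq.Build tree (compareP tree_comparable).

Fixpoint leaves (t : tree) : nat :=
  if t is Node l r then leaves l + leaves r else 1.

Lemma leaves_gt0 t : 0 < leaves t.
Proof. by elim: t => //= l IHl r IHr; rewrite addn_gt0 IHl. Qed.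

(* [fuel] bounds the depth of the recursion; it is irrelevant once [m <= fuel]. *)
Fixpoint trees_fuel (fuel m : nat) : seq tree :=
  if fuel is fuel'.+1 then
    if m == 1 then [:: Leaf] else
    flatten [seq [seq Node l r | l <- trees_fuel fuel' j, r <- trees_fuel fuel' (m - j)]
            | j <- iota 1 m.-1]
  else [::].

Definition trees (m : nat) : seq tree := trees_fuel m m.

Lemma mem_trees_fuel fuel m t :
  m <= fuel -> (t \in trees_fuel fuel m) = (leaves t == m).
Proof.
elim: fuel m t => [|fuel IH] m t le_m.
  by have := leaves_gt0 t; rewrite in_nil; case: eqP => //; lia.
rewrite /=; case: (m =P 1) => [->|m1].
  rewrite inE; case: t => [|l r] /=; first by rewrite !eqxx.
  have := leaves_gt0 l; have := leaves_gt0 r => Hl Hr.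
  by apply/eqP/eqP => //; lia.
apply/flatten_mapP/idP => [[j]|].
  rewrite mem_iota => Hj /allpairsP[[l r] /= []].
  by rewrite !IH; [move=> /eqP Hl /eqP Hr -> /= | lia..]; lia.
case: t => [|l r] /= Hm; first by lia.
have := leaves_gt0 l; have := leaves_gt0 r => Hl Hr.
exists (leaves l); first by rewrite mem_iota; lia.
by apply: allpairs_f; rewrite IH; lia.
Qed.

Lemma uniq_trees_fuel fuel m : m <= fuel -> uniq (trees_fuel fuel m).
Proof.
elim: fuel m => [|fuel IH] m le_m //=.
case: (m =P 1) => // m1.
have: uniq (iota 1 m.-1) by apply: iota_uniq.
have: all (fun j => 0 < j < m) (iota 1 m.-1).
  by apply/allP => j; rewrite mem_iota; lia.
elim: (iota _ _) => //= j s IHs /andP[Hj Hs] /andP[js us].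
rewrite cat_uniq IHs // andbT allpairs_uniq /= ?IH //; try by lia.
  apply/hasPn => t /flatten_mapP[i si /allpairsP[[l r] /= [Hl Hr ->]]].
  apply/negP => /allpairsP[[l' r'] /= [Hl' Hr' [El Er]]]; subst.
  have Hi := allP Hs _ si.
  move: Hl Hl'; rewrite !mem_trees_fuel; [move=> /eqP-> /eqP ij | lia..].
  by rewrite -ij si in js.
by move=> [l r] [l' r'] _ _ [-> ->].
Qed.

Lemma mem_trees m t : (t \in trees m) = (leaves t == m).
Proof. exact: mem_trees_fuel. Qed.

Lemma uniq_trees m : uniq (trees m).
Proof. exact: uniq_trees_fuel. Qed.

Section GeneratingSeries.

Local Open Scope ring_scope.

(** The split index runs over the full range [0..m], its extreme terms being empty sums, so that
    recurrences take the shape of [coefM], the coefficient of a product of polynomials. *)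
Lemma sum_trees (V : nmodType) (F : tree -> V) m :
  \sum_(t <- trees m) F t =
  (if m == 1%N then F Leaf else 0) +
  \sum_(j < m.+1) \sum_(l <- trees j) \sum_(r <- trees (m - j)) F (Node l r).
Proof.
have -> : \sum_(j < m.+1) \sum_(l <- trees j) \sum_(r <- trees (m - j)) F (Node l r)
  = \sum_(t <- flatten [seq [seq Node l r | l <- trees j, r <- trees (m - j)]
                       | j <- iota 0 m.+1]) F t.
  rewrite big_flatten big_map -[iota _ _]/(index_iota 0 m.+1) big_mkord.
  by apply: eq_bigr => j _; rewrite big_allpairs_dep.
have -> : (if m == 1%N then F Leaf else 0) =
   \sum_(t <- if m == 1%N then [:: Leaf] else [::]) F t.
  by case: ifP; rewrite ?big_seq1 ?big_nil.
rewrite -big_cat; apply: perm_big; apply: uniq_perm; first exact: uniq_trees.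
  rewrite cat_uniq; apply/and3P; split; first by case: ifP.
    apply/hasPn => t /flatten_mapP[j _ /allpairsP[[l r] /= [_ _ ->]]].
    by case: (m == 1%N); rewrite ?inE //; apply/eqP.
  have: uniq (iota 0 m.+1) by apply: iota_uniq.
  elim: (iota _ _) => //= j s IHs /andP[js us].
  rewrite cat_uniq IHs // andbT allpairs_uniq /= ?uniq_trees //; last first.
    by move=> [l r] [l' r'] _ _ [-> ->].
  apply/hasPn => t /flatten_mapP[i si /allpairsP[[l r] /= [Hl Hr ->]]].
  apply/negP => /allpairsP[[l' r'] /= [Hl' Hr' [El Er]]]; subst.
  by move: Hl Hl' js; rewrite !mem_trees => /eqP-> /eqP <-; rewrite si.
move=> t; rewrite mem_trees mem_cat; apply/eqP/orP => [<-|[]].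
- case: t => [|l r]; [by left; rewrite /= inE|right].
  apply/flatten_mapP; exists (leaves l); first by rewrite mem_iota /=; lia.
  by apply: allpairs_f; rewrite mem_trees //= addKn.
- by have [->|//] := eqVneq m 1%N; rewrite inE => /eqP->.
move=> /flatten_mapP[j]; rewrite mem_iota => Hj /allpairsP[[l r] /= []].
by rewrite !mem_trees => /eqP Hl /eqP Hr -> /=; lia.
Qed.

(* Coefficient [m] of [path_poly t] (resp. [cycle_poly t]) counts the paths
   with [m] edges between the ends of the root edge of the triangulation [t]
   (resp. the cycles of length [m]). *)
Fixpoint path_poly (t : tree) : {poly rat} :=
  if t is Node l r then 'X + path_poly l * path_poly r else 'X.

Fixpoint cycle_poly (t : tree) : {poly rat} :=
  if t is Node l r then
    'X * (path_poly l * path_poly r) + cycle_poly l + cycle_poly r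
  else 0.

Definition ntrees (m : nat) : rat := (size (trees m))%:R.

Definition npaths (m k : nat) : rat := \sum_(t <- trees m) (path_poly t)`_k.

Definition ncycles (m k : nat) : rat := \sum_(t <- trees m) (cycle_poly t)`_k.

Lemma ntreesE m : ntrees m = \sum_(t <- trees m) 1.
Proof. by rewrite /ntrees big_const_seq count_predT iter_addr_0. Qed.

(** This is y = x + y^2, read coefficient by coefficient. *)
Lemma ntrees_rec m :
  ntrees m = (m == 1%N)%:R + \sum_(j < m.+1) ntrees j * ntrees (m - j).
Proof.
rewrite {1}ntreesE sum_trees; congr (_ + _); first by case: eqP.
apply: eq_bigr => j _; rewrite ntreesE mulr_suml.
by apply: eq_bigr => l _; rewrite mul1r -ntreesE.
Qed.

Lemma sum_treesM (F G : tree -> rat) m m' :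
  \sum_(l <- trees m) \sum_(r <- trees m') F l * G r =
  (\sum_(l <- trees m) F l) * (\sum_(r <- trees m') G r).
Proof. by rewrite big_distrl; apply: eq_bigr => l _; rewrite big_distrr. Qed.

(** Every tree contributes its root edge, hence the term in [ntrees m]. Any other path splits at the
    apex of the root triangle, which convolves both the number of leaves and the length. *)
Lemma npaths_rec m k :
  npaths m k = (k == 1%N)%:R * ntrees m +
    \sum_(i < k.+1) \sum_(j < m.+1) npaths j i * npaths (m - j) (k - i).
Proof.
rewrite exchange_big /= {1}/npaths sum_trees ntrees_rec mulrDr -addrA.
congr (_ + _).
  by rewrite /= coefX; case: (m == _); case: (k == _); rewrite !(mul0r, mul1r).
rewrite mulr_sumr -big_split; apply: eq_bigr => j _ /=.
rewrite -/(npaths _ _).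
under eq_bigr do under eq_bigr do rewrite coefD coefX coefM.
under eq_bigr do rewrite big_split /=.
rewrite big_split /=; congr (_ + _).
  by rewrite !ntreesE -sum_treesM mulr_sumr; apply: eq_bigr => l _;
     rewrite mulr_sumr; apply: eq_bigr => r _; rewrite !mulr1.
under eq_bigr do rewrite exchange_big /=.
by rewrite exchange_big /=; apply: eq_bigr => i _; rewrite sum_treesM.
Qed.

(** A cycle using the root edge closes up a path of [k.-1] edges through the apex. Since [3 <= k],
    the path made of the root edge alone does not have this length, so [npaths m k.-1] counts only
    paths through the apex. *)
Lemma ncycles_rec m k : (3 <= k)%N ->
  ncycles m k = npaths m k.-1 +
    \sum_(j < m.+1) (ncycles j k * ntrees (m - j) + ntrees j * ncycles (m - j) k).
Proof.
case: k => [|k] //= k2; rewrite {1}/ncycles {1}/npaths !sum_trees /= coef0 coefX.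
have -> /= : (k == 1)%N = false by lia.
rewrite !if_same !add0r -big_split; apply: eq_bigr => j _ /=.
rewrite [in RHS]/ncycles !ntreesE -!sum_treesM -!big_split; apply: eq_bigr => l _ /=.
rewrite -!big_split; apply: eq_bigr => r _ /=.
rewrite !coefD coefXM coefX mulr1 mul1r -!addrA /=.
have -> : (k == 1)%N = false by lia.
rewrite /= add0r; reflexivity.
Qed.

Lemma coef0_dvdXn (F : fieldType) (p : {poly F}) N n :
  'X^N %| p -> (n < N)%N -> p`_n = 0.
Proof. by move=> /dvdpP[q ->] nN; rewrite coefMXn nN. Qed.

Lemma dvdXn_coef0 (F : fieldType) (p : {poly F}) N :
  (forall n, (n < N)%N -> p`_n = 0) -> 'X^N %| p.
Proof.
move=> p0; rewrite -(poly_take_drop N p).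
have -> : take_poly N p = 0.
  by apply/polyP => i; rewrite coef_take_poly coef0; case: ifP => // /p0.
by rewrite add0r dvdp_mull.
Qed.

(** * Generating series truncated at a fixed order *)

Section TreeSeries.

Variable N : nat.

(* Modulo ['X^N], [Y = 'X + Y ^+ 2] and [Z] is the inverse of [1 - Y *+ 2]. *)
Let Y : {poly rat} := \poly_(i < N) ntrees i.

Let Z : {poly rat} := \sum_(i < N) (Y *+ 2) ^+ i.

Lemma coef_Y n : (n < N)%N -> Y`_n = ntrees n.
Proof. by rewrite coef_poly => ->. Qed.

Lemma coef0_Y : Y`_0 = 0.
Proof. by rewrite coef_poly if_same. Qed.

Lemma dvdX_Y : 'X %| Y.
Proof. by rewrite -['X]expr1; apply: dvdXn_coef0 => -[] // _; apply: coef0_Y. Qed.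

Lemma coef_Yexp_small k n : (n < k)%N -> (Y ^+ k)`_n = 0.
Proof. by move=> nk; apply: coef0_dvdXn nk; rewrite dvdp_exp2r // dvdX_Y. Qed.

Lemma Y_quadratic : 'X^N %| Y - 'X - Y ^+ 2.
Proof.
apply: dvdXn_coef0 => n nN; rewrite !coefB coefX coef_Y // ntrees_rec.
rewrite expr2 coefM (addrC _%:R) addrK; apply/eqP; rewrite subr_eq0; apply/eqP.
by apply: eq_bigr => j _; rewrite !coef_Y //; have := ltn_ord j; lia.
Qed.

(** The geometric sum telescopes, and the remainder [(Y *+ 2) ^+ N] is a multiple of ['X^N] because
    ['X] divides [Y]. *)
Lemma Z_inverse : 'X^N %| 1 - (1 - Y *+ 2) * Z.
Proof.
have -> : (1 - Y *+ 2) * Z = 1 - (Y *+ 2) ^+ N by rewrite -[RHS]opprB subrX1 -mulNr opprB.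
rewrite opprB addrC subrK dvdp_exp2r // -scaler_nat.
by apply: dvdp_trans dvdX_Y _; rewrite -mul_polyC dvdp_mull.
Qed.

(** Expanding the factor [ntrees k] by [ntrees_rec] and writing [Y ^+ k] as [Y ^+ i * Y ^+ (k - i)]
    shows that the right-hand side satisfies the recurrence of [npaths]. *)
Lemma npathsE n k : (n < N)%N -> npaths n k = ntrees k * (Y ^+ k)`_n.
Proof.
elim/ltn_ind: n k => n IH k nN.
have n0 m : npaths 0 m = 0 by rewrite /npaths big_nil.
have y0 m : ntrees m * (Y ^+ m)`_0 = 0.
  by case: m => [|m]; [rewrite /ntrees mul0r | rewrite coef_Yexp_small ?mulr0].
rewrite npaths_rec (ntrees_rec k) mulrDl; congr (_ + _).
  by case: eqP => [->|_]; rewrite ?mul0r // !mul1r expr1 coef_Y.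
rewrite mulr_suml; apply: eq_bigr => i _.
have ik : (i <= k)%N by rewrite -ltnS.
rewrite -[in Y ^+ k](subnKC ik) exprD coefM mulr_sumr; apply: eq_bigr => j _.
rewrite mulrACA.
(* For [j = n] or [j = 0] one factor still has size [n], out of reach of the induction hypothesis,
   but the other has size 0 and vanishes on both sides. *)
have := ltn_ord j; rewrite ltnS leq_eqVlt => /orP[/eqP jn|jn].
  by rewrite jn subnn n0 y0 !mulr0.
have [j0|j_gt0] := posnP j; first by rewrite j0 n0 y0 !mul0r.
by rewrite !IH //; lia.
Qed.

(** The equation Y = X + Y^2 multiplied by Z Y^k; for the binomials of [coef_ZY] it is Pascal's
    recurrence. *)
Lemma coef_ZY_diag n k : (n < N)%N ->
  (Z * Y ^+ k.+1)`_n = (Z * Y ^+ k.+2)`_n + ('X * (Z * Y ^+ k))`_n.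
Proof.
move=> nN; apply/eqP; rewrite -subr_eq0 -coefD -coefB; apply/eqP.
apply: coef0_dvdXn nN.
suff -> : Z * Y ^+ k.+1 - (Z * Y ^+ k.+2 + 'X * (Z * Y ^+ k)) =
  (Z * Y ^+ k) * (Y - 'X - Y ^+ 2) by rewrite dvdp_mull ?Y_quadratic.
by rewrite !exprS; ring.
Qed.

Lemma coef_ZY0 k n : (n < N)%N ->
  (Y ^+ k)`_n = (Z * Y ^+ k)`_n - (Z * Y ^+ k.+1)`_n *+ 2.
Proof.
move=> nN; apply/eqP; rewrite -coefMn -coefB -subr_eq0 -coefB; apply/eqP.
apply: coef0_dvdXn nN.
suff -> : Y ^+ k - (Z * Y ^+ k - Z * Y ^+ k.+1 *+ 2) =
   Y ^+ k * (1 - (1 - Y *+ 2) * Z) by rewrite dvdp_mull ?Z_inverse.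
by rewrite !exprS; ring.
Qed.

(** Outer induction on [n], inner downward induction on [k], starting from [n < k], where the
    coefficient vanishes because ['X^k] divides [Y ^+ k]. *)
Lemma coef_ZY k n : (n < N)%N ->
  (Z * Y ^+ k)`_n = if (k <= n)%N then 'C(2 * n - k, n)%:R else 0.
Proof.
elim/ltn_ind: n k => n IH k nN.
move Ed : (n.+1 - k)%N => d; elim: d k Ed => [|d IHd] k Ed.
  have nk : (n < k)%N by lia.
  rewrite leqNgt nk /=; apply: coef0_dvdXn nk.
  by rewrite dvdp_mull // dvdp_exp2r // dvdX_Y.
have kn : (k <= n)%N by lia.
rewrite kn; case: k => [|k] in Ed kn *.
  (* At [k = 0] the diagonal recurrence is replaced by Z = 1 + 2 Y Z: a central binomial coefficient
     is twice its neighbour in the row above. *)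
  have := coef_ZY0 0 nN; rewrite expr0 coef1 => /eqP.
  rewrite eq_sym subr_eq => /eqP ->; rewrite IHd; last by lia.
  case: n nN {IH kn Ed IHd} => [|n] nN //; rewrite add0r /= subn0.
  have -> : (2 * n.+1 = (2 * n).+2)%N by lia.
  rewrite subn1 /= [in RHS]binS natrD mulr2n; congr (_ + _).
  have -> : ('C((2 * n).+1, n) = 'C((2 * n).+1, n.+1))%N.
    rewrite -[LHS]bin_sub; last by lia.
    by congr 'C(_, _); lia.
  by [].
rewrite coef_ZY_diag // coefXM IHd; last by lia.
case: n kn nN IH {IHd Ed} => [|n] //= kn nN IH.
rewrite IH //; last by lia.
rewrite (_ : (k <= n)%N); last by lia.
have [k_lt|k_ge] := ltnP k n.
  rewrite (_ : (k.+2 <= n.+1)%N) //.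
  have -> : (2 * n.+1 - k.+1 = (2 * n - k).+1)%N by lia.
  by rewrite binS natrD; congr (_ + _); congr (_%:R); congr 'C(_, _); lia.
have -> : (k.+2 <= n.+1)%N = false by lia.
have -> : (2 * n.+1 - k.+1 = n.+1)%N by lia.
have -> : (2 * n - k = n)%N by lia.
rewrite !binn add0r; reflexivity.
Qed.

(** With B the series of the [ncycles i k] and c = [ntrees k.-1], the recurrence reads B = c Y^(k-1)
    + 2 Y B; multiplication by Z solves it. *)
Lemma ncycles_coef n k : (3 <= k)%N -> (n < N)%N ->
  ncycles n k = ntrees k.-1 * (Z * Y ^+ k.-1)`_n.
Proof.
move=> k3 nN.
pose B : {poly rat} := \poly_(i < N) ncycles i k.
have BE i : (i < N)%N -> B`_i = ncycles i k by rewrite coef_poly => ->.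
have H : 'X^N %| (1 - Y *+ 2) * B - (ntrees k.-1)%:P * Y ^+ k.-1.
  apply: dvdXn_coef0 => i iN.
  rewrite coefB coefCM -npathsE // mulrBl mul1r mulrnAl coefB BE // ncycles_rec //.
  rewrite coefMn big_split /= mulr2n addrAC addrAC -addrA.
  set S1 := \sum_(j < _) _; set S2 := \sum_(j < _) _.
  (* Reversing the summation index exchanges the left and right polygons. *)
  have -> : S1 = S2.
    rewrite /S1 (reindex_inj rev_ord_inj) /=; apply: eq_bigr => j _.
    by rewrite subSS subKn -1?ltnS // mulrC.
  have -> : (Y * B)`_i = S2.
    rewrite coefM; apply: eq_bigr => j _; rewrite coef_Y ?BE //;
      by have := ltn_ord j; lia.
  ring.
rewrite -BE //; apply/eqP; rewrite -coefCM -subr_eq0 -coefB; apply/eqP.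
apply: coef0_dvdXn nN.
rewrite (_ : _ - _ = Z * ((1 - Y *+ 2) * B - (ntrees k.-1)%:P * Y ^+ k.-1)
   + B * (1 - (1 - Y *+ 2) * Z)); last by ring.
by rewrite dvdp_add // dvdp_mull // Z_inverse.
Qed.

Lemma ntrees_coef n : (n < N)%N -> ntrees n = (Z * Y ^+ 1)`_n - (Z * Y ^+ 2)`_n *+ 2.
Proof. by move=> nN; rewrite -coef_ZY0 // expr1 coef_Y. Qed.

End TreeSeries.

(** The coefficient of Y = ZY - 2 Z Y^2 is C(2m+1, m+1) - 2 C(2m, m+1) = C(2m, m) - C(2m, m+1), and
    (m+1) C(2m, m+1) = m C(2m, m). For [m = 0] the second term is the default value 0. *)
Lemma ntrees_catalan m : ntrees m.+1 = 'C(2 * m, m)%:R / m.+1%:R.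
Proof.
have m1 : (m.+1 < m.+2)%N by [].
rewrite (ntrees_coef m1) !coef_ZY //.
have -> : (2 * m.+1 - 1 = (2 * m).+1)%N by lia.
have -> : (2 * m.+1 - 2 = 2 * m)%N by lia.
apply: (canRL (mulfK _)); first by rewrite pnatr_eq0.
have E : ('C(2 * m, m.+1) * m.+1 = m * 'C(2 * m, m))%N.
  by rewrite mulnC mul_bin_left; congr (_ * _)%N; lia.
have [->|m_gt0] := posnP m; first by rewrite /=.
rewrite !ltnS leq0n m_gt0 binS natrD.
move: ('C(_, _)) ('C(_, _)) E => b a /(congr1 (fun x => x%:R : rat)).
rewrite !natrM -natr1 => E.
transitivity (b%:R * (m%:R + 1) - a%:R * (m%:R + 1) : rat); first by ring.
by rewrite E; ring.
Qed.

Lemma ncyclesE m k : (3 <= k <= m.+1)%N ->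
  ncycles m k = ntrees k.-1 * 'C(2 * m - k.-1, m)%:R.
Proof.
move=> /andP[k3 km]; rewrite (@ncycles_coef m.+1) // coef_ZY //.
by rewrite (_ : (k.-1 <= m)%N) //; lia.
Qed.

End GeneratingSeries.

(** * Chords, paths and cycles of a tree *)

(* The edges (sides included) of the triangulation, encoded by [t], of the
   polygon with vertices [a], ..., [a + leaves t]: the root edge joins the two
   extreme vertices and a [Node] is the triangle resting on it. *)
Fixpoint chords (t : tree) (a : nat) : seq (nat * nat) :=
  (a, a + leaves t) ::
  if t is Node l r then chords l a ++ chords r (a + leaves l) else [::].

Lemma mem_chords_Node l r a p :
  (p \in chords (Node l r) a) =
  [|| p == (a, a + leaves (Node l r)), p \in chords l a
    | p \in chords r (a + leaves l)].
Proof. by rewrite in_cons mem_cat. Qed.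

Lemma chords_bound t a x y :
  (x, y) \in chords t a -> [&& a <= x, x < y & y <= a + leaves t].
Proof.
elim: t a x y => [|l IHl r IHr] a x y.
  by rewrite inE => /eqP[-> ->] /=; lia.
have := leaves_gt0 l; have := leaves_gt0 r => Hl Hr.
rewrite mem_chords_Node => /or3P[/eqP[-> ->]|/IHl|/IHr] /=; lia.
Qed.

Lemma root_chords t a : (a, a + leaves t) \in chords t a.
Proof. by case: t => [|l r]; rewrite mem_head. Qed.

Lemma sides_chords t a i : a <= i < a + leaves t -> (i, i.+1) \in chords t a.
Proof.
elim: t a => [|l IHl r IHr] a /= Hi.
  by rewrite inE; apply/eqP; congr (_, _); lia.
rewrite mem_chords_Node; apply/or3P.
have [i_lt|i_ge] := ltnP i (a + leaves l); [constructor 2 | constructor 3].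
  by apply: IHl; lia.
by apply: IHr; lia.
Qed.

Lemma size_chords t a : size (chords t a) = (2 * leaves t).-1.
Proof.
elim: t a => [|l IHl r IHr] a //=; rewrite size_cat IHl IHr.
by have := leaves_gt0 l; have := leaves_gt0 r; lia.
Qed.

Lemma uniq_chords t a : uniq (chords t a).
Proof.
elim: t a => [|l IHl r IHr] a //=.
have := leaves_gt0 l; have := leaves_gt0 r => Hl Hr.
rewrite cat_uniq IHl IHr mem_cat negb_or andbT /=; apply/andP; split.
  by apply/andP; split; apply/negP => /chords_bound; lia.
by apply/hasPn => -[x y] /chords_bound H; apply/negP => /chords_bound; lia.
Qed.

(** Two chords of the same subpolygon are handled by induction; chords of different subpolygons have
    at most the apex in common, and the root chord spans everything. *)
Lemma chords_noncrossing t a x y z w :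
  (x, y) \in chords t a -> (z, w) \in chords t a -> ~~ (x < z < y) || (w <= y).
Proof.
elim: t a x y z w => [|l IHl r IHr] a x y z w.
  by rewrite !inE => /eqP[-> ->] /eqP[-> ->]; lia.
have := leaves_gt0 l; have := leaves_gt0 r => Hl Hr.
rewrite !mem_chords_Node /=.
case/or3P=> [/eqP[-> ->]|p_l|p_r]; case/or3P=> [/eqP[-> ->]|q_l|q_r];
  try exact: (IHl a); try exact: (IHr (a + leaves l));
  do ?[move: p_l => /chords_bound | move: p_r => /chords_bound
      | move: q_l => /chords_bound | move: q_r => /chords_bound]; lia.
Qed.

Lemma chords_left l r a x y : (x, y) \in chords (Node l r) a ->
  y <= a + leaves l -> (x, y) \in chords l a.
Proof.
have := leaves_gt0 l; have := leaves_gt0 r => Hl Hr.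
by rewrite mem_chords_Node /= => /or3P[/eqP[-> ->]||/chords_bound] //; lia.
Qed.

Lemma chords_right l r a x y : (x, y) \in chords (Node l r) a ->
  a + leaves l <= x -> (x, y) \in chords r (a + leaves l).
Proof.
have := leaves_gt0 l; have := leaves_gt0 r => Hl Hr.
by rewrite mem_chords_Node /= => /or3P[/eqP[-> ->]|/chords_bound|] //; lia.
Qed.

Lemma chords_leftE l r a x y :
  ((x, y) \in chords l a) =
  ((x, y) \in chords (Node l r) a) && (y <= a + leaves l).
Proof.
apply/idP/andP => [H|[]]; last exact: chords_left.
by rewrite mem_chords_Node H orbT; move: H => /chords_bound; lia.
Qed.

Lemma chords_rightE l r a x y :
  ((x, y) \in chords r (a + leaves l)) =
  ((x, y) \in chords (Node l r) a) && (a + leaves l <= x).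
Proof.
apply/idP/andP => [H|[]]; last exact: chords_right.
by rewrite mem_chords_Node H !orbT; move: H => /chords_bound; lia.
Qed.

(** The chords determine the apex: a chord from [a] other than the root ends at the apex at the
    latest. Applying this in both directions equates the two apexes. *)
Lemma chords_inj t u a :
  leaves t = leaves u -> chords t a =i chords u a -> t = u.
Proof.
elim: t u a => [|l IHl r IHr] [|l' r'] a //=.
- by have := leaves_gt0 l'; have := leaves_gt0 r'; lia.
- by have := leaves_gt0 l; have := leaves_gt0 r; lia.
move=> Hlr E.
have apex (t1 t2 s1 s2 : tree) : leaves t1 + leaves t2 = leaves s1 + leaves s2 ->
  chords (Node t1 t2) a =i chords (Node s1 s2) a -> leaves t1 <= leaves s1.
  move=> Es Ec.
  have := leaves_gt0 t1; have := leaves_gt0 t2; have := leaves_gt0 s1 => H1 H2 H3.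
  have : (a, a + leaves t1) \in chords (Node s1 s2) a.
    by rewrite -Ec mem_chords_Node root_chords orbT.
  rewrite mem_chords_Node /= => /or3P[/eqP[]|/chords_bound|/chords_bound]; lia.
have El : leaves l = leaves l'.
  by apply/eqP; rewrite eqn_leq (apex l r l' r') // (apex l' r' l r).
congr Node.
  apply: (IHl _ a El) => -[x y].
  by rewrite (chords_leftE l r) (chords_leftE l' r') El E.
apply: (IHr _ (a + leaves l)); first by lia.
move=> [x y]; rewrite (chords_rightE l r) E.
by rewrite El (chords_rightE l' r').
Qed.

(* The apex of the triangle resting on the root edge is the largest vertex
   adjacent to [a], the far end [a + m] excepted. *)
Lemma noncrossing_max m a (F : seq (nat * nat)) : 0 < m -> uniq F ->
  (forall x y, (x, y) \in F -> [&& a <= x, x < y & y <= a + m]) ->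
  (a, a + m) \in F ->
  (forall i, a <= i < a + m -> (i, i.+1) \in F) ->
  (forall x y z w, (x, y) \in F -> (z, w) \in F -> ~~ (x < z < y) || (w <= y)) ->
  size F <= (2 * m).-1 /\
  (size F = (2 * m).-1 -> exists2 t, leaves t = m & F =i chords t a).
Proof.
elim/ltn_ind: m a F => m IH a F m0 uF bF rF sF nF.
have [m1|m1] := leqP m 1.
  have Em : m = 1 by lia.
  have F_sub : {subset F <= [:: (a, a.+1)]}.
    move=> [x y] /bF H; rewrite inE; apply/eqP; congr (_, _); lia.
  have szF := uniq_leq_size uF F_sub; rewrite Em; split=> // sz1.
  exists Leaf => // p; rewrite /= addn1.
  by have [_ ->] := uniq_min_size uF F_sub (eq_leq (esym sz1)).
pose P j := (j < m) && ((a, a + j) \in F).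
have exP : exists j, P j.
  by exists 1; rewrite /P m1 addn1 sF //; lia.
have ubP j : P j -> j <= m by move=> /andP[/ltnW].
case: (ex_maxnP exP ubP) => j /andP[jm jF] maxj.
have j0 : 0 < j by have := bF _ _ jF; lia.
pose F1 := [seq p <- F | p.2 <= a + j].
pose F2' := [seq p <- F | [&& a + j <= p.1 & p != (a + j, a + m)]].
(* The edge from the apex to [a + m] is not yet known to belong to [F]. It is added as the root edge
   of the right polygon, and filtered out of [F2'] to avoid a repetition. *)
pose F2 := (a + j, a + m) :: F2'.
have mF1 x y : ((x, y) \in F1) = (y <= a + j) && ((x, y) \in F).
  by rewrite mem_filter.
have mF2 x y : (x, y) \in F2 -> (x, y) = (a + j, a + m) \/
   (a + j <= x /\ (x, y) \in F).
  rewrite inE mem_filter /= => /orP[/eqP->|/andP[/andP[]]]; first by left.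
  by right.
have mF2_F x y : a + j <= x -> (x, y) \in F -> (x, y) \in F2.
  move=> jx xyF; rewrite inE mem_filter /= jx xyF andbT.
  by case: eqP.
have uF1 : uniq F1 by rewrite filter_uniq.
have uF2 : uniq F2.
  by rewrite /= filter_uniq // andbT mem_filter /= eqxx andbF.
have F_sub : {subset F <= (a, a + m) :: F1 ++ F2}.
  move=> [x y] xyF; rewrite inE mem_cat mF1 xyF andbT.
  have [->|ne] := eqVneq (x, y) (a, a + m) => //=.
  have [//|jy] /= := leqP y (a + j).
  apply: mF2_F => //; have := bF _ _ xyF => /and3P[ax xy ym].
  have [xa|xa] := eqVneq x a.
    case/eqP: ne; subst x; congr (_, _); apply/eqP.
    rewrite eqn_leq ym leqNgt; apply/negP => ym'.
    by have := maxj (y - a); rewrite /P subnKC ?xyF ?andbT; lia.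
  by have := nF _ _ _ _ jF xyF; lia.
have [|||||||szF1 tF1] := IH j _ a F1 => //.
- by move=> x y; rewrite mF1 => /andP[yj /bF]; lia.
- by rewrite mF1 leqnn.
- by move=> i Hi; rewrite mF1 sF; lia.
- by move=> x y z w; rewrite !mF1 => /andP[_ H] /andP[_ H']; apply: nF.
have [|||||||szF2 tF2] := IH (m - j) _ (a + j) F2 => //.
- lia.
- lia.
- by move=> x y /mF2 [[-> ->]|[jx /bF]]; lia.
- by rewrite (_ : a + j + (m - j) = a + m) ?mem_head //; lia.
- by move=> i Hi; apply: mF2_F; [lia | apply: sF; lia].
- move=> x y z w /mF2 [[-> ->]|[jx xyF]] /mF2 [[-> ->]|[jz zwF]].
  + lia.
  + by have := bF _ _ zwF; lia.
  + by have := bF _ _ xyF; lia.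
  + exact: nF.
(* With the inductive bounds this gives at most 1 + (2j - 1) + (2(m - j) - 1) = 2m - 1 edges.
   Equality forces both parts to be of maximal size, hence to come from trees. *)
have szF : size F <= (size F1 + size F2).+1.
  by rewrite -size_cat; apply: uniq_leq_size uF F_sub.
split=> [|sz]; first by lia.
have [t1 lt1 ct1] := tF1 ltac:(lia).
have [t2 lt2 ct2] := tF2 ltac:(lia).
exists (Node t1 t2) => [/=|p]; first by lia.
have sz' : size ((a, a + m) :: F1 ++ F2) <= size F by rewrite /= size_cat; lia.
have [_ ->] := uniq_min_size uF F_sub sz'.
rewrite mem_chords_Node inE mem_cat ct1 ct2 lt1 /= lt1 lt2.
by rewrite (_ : j + (m - j) = m) //; lia.
Qed.

(** * Increasing paths and cycles along the chords *)

Definition chord_rel (t : tree) (a : nat) : rel nat :=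
  [rel x y | (x, y) \in chords t a].

Lemma chord_relE t a x y : chord_rel t a x y = ((x, y) \in chords t a).
Proof. by []. Qed.

(* The paths from [a] to [a + leaves t], given without their first vertex [a]. *)
Fixpoint chord_paths (t : tree) (a : nat) : seq (seq nat) :=
  [:: a + leaves t] ::
  if t is Node l r then
    [seq p ++ q | p <- chord_paths l a, q <- chord_paths r (a + leaves l)]
  else [::].

(** A cycle is listed increasingly from its smallest vertex, and closes up along the chord joining
    its extreme vertices. The cycles through the root edge come first. *)
Fixpoint chord_cycles (t : tree) (a : nat) : seq (seq nat) :=
  if t is Node l r then
    [seq a :: (p ++ q) | p <- chord_paths l a, q <- chord_paths r (a + leaves l)]
    ++ chord_cycles l a ++ chord_cycles r (a + leaves l)
  else [::].

Lemma chord_path_le t a x p : path (chord_rel t a) x p -> x <= last x p.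
Proof.
elim: p x => //= y p IH x /andP[/chords_bound H /IH]; lia.
Qed.

Lemma chord_path_sorted t a x p :
  path (chord_rel t a) x p -> sorted ltn (x :: p).
Proof. by apply: sub_path => u v /chords_bound /and3P[]. Qed.

Lemma path_left l r a x p : path (chord_rel (Node l r) a) x p ->
  last x p <= a + leaves l -> path (chord_rel l a) x p.
Proof.
elim: p x => //= y p IH x /andP[xy yp] H; rewrite IH // andbT.
by apply: chords_left xy _; have := chord_path_le yp; lia.
Qed.

Lemma path_right l r a x p : path (chord_rel (Node l r) a) x p ->
  a + leaves l <= x -> path (chord_rel r (a + leaves l)) x p.
Proof.
elim: p x => //= y p IH x /andP[xy yp] H.
rewrite IH //; last by have := chords_bound xy; lia.
by rewrite andbT; apply: chords_right xy _.
Qed.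

Lemma path_left_Node l r a x p :
  path (chord_rel l a) x p -> path (chord_rel (Node l r) a) x p.
Proof. by apply: sub_path => u v; rewrite !chord_relE (chords_leftE l r) => /andP[]. Qed.

Lemma path_right_Node l r a x p :
  path (chord_rel r (a + leaves l)) x p -> path (chord_rel (Node l r) a) x p.
Proof. by apply: sub_path => u v; rewrite !chord_relE (chords_rightE l r) => /andP[]. Qed.

(** No chord starting strictly between [a] and the apex jumps over the apex, so an increasing path
    must stop there. *)
Lemma path_apex l r a x p : path (chord_rel (Node l r) a) x p ->
  a < x <= a + leaves l -> a + leaves l <= last x p ->
  exists p1 p2, p = p1 ++ p2 /\ last x p1 = a + leaves l.
Proof.
elim: p x => [|y p IH] x /=.
  by move=> _ Hx H; exists [::], [::]; split => //=; lia.
move=> /andP[xy yp] Hx H.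
have [xj|xj] := eqVneq x (a + leaves l); first by exists [::], (y :: p).
have Hy : a < y <= a + leaves l.
  have := chords_bound xy; move: xy.
  by rewrite chord_relE mem_chords_Node => /or3P[/eqP[]|/chords_bound|/chords_bound]; lia.
have [p1 [p2 [-> H1]]] := IH y yp Hy H.
by exists (y :: p1), p2.
Qed.

(** The first step either is the root chord, after which an increasing path cannot continue, or
    lands at or before the apex, and then [path_apex] cuts the path into one of each subpolygon. *)
Lemma mem_chord_paths t a p :
  (p \in chord_paths t a) =
  path (chord_rel t a) a p && (last a p == a + leaves t).
Proof.
elim: t a p => [|l IHl r IHr] a p.
  rewrite inE; case: p => [|x p] /=; first by apply/eqP/eqP => //; lia.
  rewrite chord_relE inE; case: p => [|y p] /=.
    by apply/eqP/andP => [[->]|[/andP[/eqP[->]]] //]; rewrite !eqxx.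
  rewrite eqseq_cons andbF; apply/esym/negbTE/negP => /andP[/andP[/eqP[->]]].
  by rewrite chord_relE inE xpair_eqE; lia.
have := leaves_gt0 l; have := leaves_gt0 r => Hr Hl.
rewrite in_cons; apply/orP/andP => [[/eqP->|]|[]].
- by split=> //=; rewrite andbT; apply: (root_chords (Node l r)).
- case/allpairsP=> -[p1 p2] /= [].
  rewrite IHl IHr => /andP[P1 /eqP L1] /andP[P2 /eqP L2] ->.
  rewrite cat_path last_cat L1 L2 (path_left_Node r P1) (path_right_Node P2).
  by split=> //; rewrite addnA.
case: p => [|x p] /=; first by move=> _ /eqP; lia.
move=> /andP[ax xp] /eqP L.
have [xb|xb] := eqVneq x (a + leaves (Node l r)).
  left; case: p xp L => [|y p] /= => [_ _|/andP[/chords_bound]].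
    by rewrite -xb.
  by move: xb => /=; lia.
right.
have Hx : a < x <= a + leaves l.
  move: ax; rewrite chord_relE mem_chords_Node => /or3P[/eqP[E]||].
  - by rewrite E eqxx in xb.
  - by move=> /chords_bound; lia.
  - by move=> /chords_bound; lia.
have [|p1 [p2 [Ep L1]]] := path_apex xp Hx; first by lia.
apply/allpairsP; exists (x :: p1, p2); rewrite /= IHl IHr /= Ep.
move: xp L; rewrite Ep cat_path last_cat L1 => /andP[P1 P2] L.
rewrite eqxx (path_left P1) ?L1 // (path_right P2) // L addnA eqxx /=.
by rewrite chord_relE (chords_left ax) //; case/andP: Hx.
Qed.

Lemma chord_paths_neq0 t a p : p \in chord_paths t a -> 0 < size p.
Proof.
rewrite mem_chord_paths; case: p => //= /eqP.
by have := leaves_gt0 t; lia.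
Qed.

(** The closing chord locates the cycle: an increasing path stays between its ends, so it remains in
    the subpolygon containing that chord. The condition [1 < size p] discards the root edge closed
    up by itself. *)
Lemma mem_chord_cycles t a x p :
  (x :: p \in chord_cycles t a) =
  [&& 1 < size p, path (chord_rel t a) x p & (x, last x p) \in chords t a].
Proof.
elim: t a x p => [|l IHl r IHr] a x p.
  rewrite in_nil; symmetry; apply/negbTE/negP => /and3P[].
  case: p => [|y [|z p]] //= _ /and3P[+ + _] _.
  by rewrite !chord_relE !inE !xpair_eqE /=; lia.
rewrite mem_cat [in X in _ || X]mem_cat IHl IHr; apply/or3P/and3P.
  case=> [/allpairsP[[p1 p2] /= [P1 P2 [-> ->]]]|/and3P[sp pp lp]|/and3P[sp pp lp]].
  - have : p1 ++ p2 \in chord_paths (Node l r) a.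
      by rewrite inE allpairs_f ?orbT.
    rewrite mem_chord_paths => /andP[-> /eqP ->]; rewrite root_chords size_cat.
    by split=> //; apply: leq_add (chord_paths_neq0 P1) (chord_paths_neq0 P2).
  - by rewrite mem_chords_Node lp orbT; split=> //; apply: path_left_Node.
  - by rewrite mem_chords_Node lp !orbT; split=> //; apply: path_right_Node.
case=> sp pp; rewrite mem_chords_Node => /or3P[/eqP[ax lx]|lp|lp].
- subst x; have : p \in chord_paths (Node l r) a.
    by rewrite mem_chord_paths pp lx eqxx.
  rewrite inE => /orP[/eqP E|/allpairsP[[p1 p2] /= [P1 P2 ->]]].
    by rewrite E in sp.
  by constructor 1; apply/allpairsP; exists (p1, p2).
- by constructor 2; rewrite sp lp (path_left pp) //; case/and3P: (chords_bound lp).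
- by constructor 3; rewrite sp lp (path_right pp) //; case/and3P: (chords_bound lp).
Qed.

Lemma nil_chord_cycles t a : [::] \notin chord_cycles t a.
Proof.
elim: t a => [|l IHl r IHr] a //=; rewrite !mem_cat !negb_or IHl IHr !andbT.
by apply/negP => /allpairsP[[p q] /= []].
Qed.

Lemma chord_paths_bound t a p :
  p \in chord_paths t a -> all (fun x => a < x <= a + leaves t) p.
Proof.
elim: t a p => [|l IHl r IHr] a p; rewrite inE.
  by move=> /eqP -> /=; rewrite andbT; lia.
have := leaves_gt0 l; have := leaves_gt0 r => Hr Hl.
case/orP=> [/eqP-> /=|/allpairsP[[p1 p2] /= [/IHl P1 /IHr P2 ->]]].
  by rewrite andbT; lia.
rewrite all_cat; apply/andP; split.
  by apply: sub_all P1 => x; lia.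
by apply: sub_all P2 => x; lia.
Qed.

(** The first path is recovered from the concatenation as its vertices up to the apex. *)
Lemma cat_chord_paths_inj l r a p q p' q' :
  p \in chord_paths l a -> q \in chord_paths r (a + leaves l) ->
  p' \in chord_paths l a -> q' \in chord_paths r (a + leaves l) ->
  p ++ q = p' ++ q' -> p = p' /\ q = q'.
Proof.
pose f := filter (fun x => x <= a + leaves l).
have Hf u v : u \in chord_paths l a -> v \in chord_paths r (a + leaves l) ->
    f (u ++ v) = u.
  move=> /chord_paths_bound Hu /chord_paths_bound Hv.
  rewrite /f filter_cat (all_filterP _); last by apply: sub_all Hu => x /andP[].
  rewrite (_ : filter _ v = [::]) ?cats0 //.
  apply/eqP; rewrite -[_ == _]negbK -has_filter -all_predC.
  by apply: sub_all Hv => x /=; lia.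
move=> Hp Hq Hp' Hq' E; have Ep : p = p' by rewrite -(Hf p q) // E Hf.
by split=> //; move: E; rewrite Ep => /(congr1 (drop (size p'))); rewrite !drop_size_cat.
Qed.

Lemma uniq_cat_chord_paths l r a :
  uniq (chord_paths l a) -> uniq (chord_paths r (a + leaves l)) ->
  uniq [seq p ++ q | p <- chord_paths l a, q <- chord_paths r (a + leaves l)].
Proof.
move=> Ul Ur; apply: allpairs_uniq => // u v.
case/allpairsP=> -[p q] /= [Hp Hq ->] /allpairsP[[p' q'] /= [Hp' Hq' ->]] /=.
by case/(cat_chord_paths_inj Hp Hq Hp' Hq') => -> ->.
Qed.

Lemma uniq_chord_paths t a : uniq (chord_paths t a).
Proof.
elim: t a => [|l IHl r IHr] a //=; rewrite uniq_cat_chord_paths // andbT.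
apply/negP => /allpairsP[[p q] /= [/chord_paths_neq0 + /chord_paths_neq0 + E]].
by have := congr1 size E; rewrite size_cat /=; lia.
Qed.

Lemma uniq_chord_cycles t a : uniq (chord_cycles t a).
Proof.
elim: t a => [|l IHl r IHr] a //=.
have := leaves_gt0 l; have := leaves_gt0 r => Hr Hl.
have -> : [seq a :: (p ++ q) | p <- chord_paths l a, q <- chord_paths r (a + leaves l)]
  = map (cons a) [seq p ++ q | p <- chord_paths l a, q <- chord_paths r (a + leaves l)].
  by rewrite map_allpairs.
rewrite !cat_uniq IHl IHr map_inj_uniq; last by move=> ? ? [].
rewrite uniq_cat_chord_paths ?uniq_chord_paths //= andbT; apply/andP; split.
  (* The three families are told apart by the closing chord, from the first vertex to the last: it
     is the root chord, or lies on the left or on the right of the apex. *)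
  apply/hasPn => s; rewrite mem_cat => Hs; apply/negP => /mapP[p /allpairsP].
  move=> [[p1 p2] /= [P1 P2 Ep]] Es; move: Hs; rewrite {s}Es.
  have : p \in chord_paths (Node l r) a by rewrite Ep inE allpairs_f ?orbT.
  rewrite mem_chord_paths => /andP[_ /eqP Lp].
  rewrite !mem_chord_cycles Lp /= => /orP[] /and3P[_ _ /chords_bound]; lia.
apply/hasPn => -[|x p]; first by rewrite (negbTE (nil_chord_cycles _ _)).
rewrite !mem_chord_cycles => /and3P[_ _ /chords_bound H].
by apply/negP => /and3P[_ _ /chords_bound]; lia.
Qed.

Section CycleCount.

Local Open Scope ring_scope.

Lemma sum_chord_paths t a :
  \sum_(p <- chord_paths t a) 'X^(size p) = path_poly t.
Proof.
elim: t a => [|l IHl r IHr] a; first by rewrite big_seq1.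
rewrite /= big_cons big_allpairs_dep; congr (_ + _).
rewrite -(IHl a) -(IHr (a + leaves l)%N) big_distrl; apply: eq_bigr => p _ /=.
by rewrite big_distrr; apply: eq_bigr => q _; rewrite size_cat exprD.
Qed.

(** A path omits its first vertex while a cycle includes it, so [size] counts edges in both cases;
    the added vertex accounts for the factor ['X] of the root edge. *)
Lemma sum_chord_cycles t a :
  \sum_(s <- chord_cycles t a) 'X^(size s) = cycle_poly t.
Proof.
elim: t a => [|l IHl r IHr] a; first by rewrite big_nil.
rewrite /= !big_cat IHl IHr /= addrA; congr (_ + _ + _).
rewrite -(sum_chord_paths l a) -(sum_chord_paths r (a + leaves l)).
rewrite big_allpairs_dep big_distrl big_distrr; apply: eq_bigr => p _ /=.
rewrite !big_distrr; apply: eq_bigr => q _ /=.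
by rewrite size_cat exprS exprD.
Qed.

Lemma coef_cycle_poly t a k :
  (cycle_poly t)`_k = (count (fun s => size s == k) (chord_cycles t a))%:R.
Proof.
rewrite -(sum_chord_cycles t a) coef_sum -sum1_count natr_sum [in RHS]big_mkcond.
by apply: eq_bigr => s _; rewrite coefXn eq_sym; case: eqP.
Qed.

End CycleCount.

(** * Cycles in noncrossing graphs *)

Lemma next_cat (T : eqType) (x : T) p1 p2 :
  uniq (p1 ++ x :: p2) -> next (p1 ++ x :: p2) x = head x (p2 ++ p1).
Proof.
move=> U; rewrite -(next_rot (size p1) U) rot_size_cat /=.
by case: (p2 ++ p1) => [|y q] /=; rewrite eqxx.
Qed.

(** A discrete intermediate value argument: take the first edge where [P] changes, and orient it by
    symmetry. *)
Lemma path_change (T : eqType) (e : rel T) (P : pred T) x p :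
  symmetric e -> path e x p -> has P (x :: p) -> has (predC P) (x :: p) ->
  exists u v, [/\ u \in x :: p, v \in x :: p, e u v, P u & ~~ P v].
Proof.
move=> e_sym; elim: p x => [|y p IH] x; first by move=> _ /= /orP[->|].
move=> /andP[xy yp]; have [Py|Py] := boolP (P x == P y); last first.
  move=> _ _; have [Px|Px] := boolP (P x).
    by exists x, y; rewrite !inE !eqxx orbT; split=> //; move: Py; rewrite Px; case: (P y).
  exists y, x; rewrite !inE !eqxx orbT e_sym; split=> //.
  by move: Py; rewrite (negbTE Px); case: (P y).
have same (Q : pred T) : Q x = Q y -> has Q [:: x, y & p] -> has Q (y :: p).
  by rewrite /= => ->; case: (Q y).
move=> /same H1 /same H2.
have [|u [v [up vp uv Pu Pv]]] := IH y yp (H1 (eqP Py)).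
  by apply: H2; rewrite /= (eqP Py).
by exists u, v; split=> //; rewrite inE ?up ?vp orbT.
Qed.

Section Polygon.

Variable n : nat.

Definition ord_lt : rel 'I_n := [rel x y : 'I_n | x < y].

Lemma ord_lt_trans : transitive ord_lt.
Proof. by move=> y x z; apply: ltn_trans. Qed.

Lemma sorted_ord_uniq (s : seq 'I_n) : sorted ord_lt s -> uniq s.
Proof. by apply: sorted_uniq; [apply: ord_lt_trans | move=> x; apply: ltnn]. Qed.

Lemma sorted_ord_cat (p1 p2 : seq 'I_n) x : sorted ord_lt (p1 ++ x :: p2) ->
  {in p1, forall y : 'I_n, y < x} /\ {in p2, forall y : 'I_n, x < y}.
Proof.
rewrite (sorted_pairwise ord_lt_trans) pairwise_cat /= => /and3P[/allrelP H _ /andP[/allP H' _]].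
by split=> y Hy; [apply: H; rewrite ?mem_head | apply: H'].
Qed.

(** First kind of edge of an increasing cycle: the step from a vertex to the next larger one. *)
Lemma next_sorted_between (s : seq 'I_n) (x y : 'I_n) : sorted ord_lt s ->
  x \in s -> y \in s -> x < y -> {in s, forall z : 'I_n, ~~ (x < z < y)} ->
  next s x = y.
Proof.
move=> S /splitPr sx; case: sx S => p1 p2 S ys xy between.
have [H1 H2] := sorted_ord_cat S.
rewrite next_cat ?sorted_ord_uniq //.
have: y \in p2.
  move: ys; rewrite mem_cat inE => /or3P[/H1|/eqP E|//]; first by lia.
  by rewrite E ltnn in xy.
case: p2 S H2 between {ys} => [|z p2] //= S H2 between; rewrite inE => /orP[/eqP//|yp].
have := between z; rewrite mem_cat !inE eqxx !orbT H2 ?mem_head //= => /(_ isT).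
move: S; rewrite -cat_rcons => /sorted_ord_cat[_ H3].
by rewrite H3.
Qed.

(** Second kind of edge: the closing one, from the largest vertex back to the smallest. *)
Lemma next_sorted_extreme (s : seq 'I_n) (x y : 'I_n) : sorted ord_lt s ->
  x \in s -> y \in s -> x < y -> {in s, forall z : 'I_n, x <= z <= y} ->
  next s y = x.
Proof.
move=> S xs /splitPr sy; case: sy S xs => p1 p2 S xs xy extreme.
have [H1 H2] := sorted_ord_cat S.
rewrite next_cat ?sorted_ord_uniq //.
have p2_nil : p2 = [::].
  case: p2 H2 extreme {S xs} => // z p2 H2 extreme.
  have := H2 z (mem_head _ _); have := extreme z.
  by rewrite mem_cat !inE eqxx !orbT => /(_ isT); lia.
move: S xs extreme H1; rewrite {}p2_nil {H2} mem_cat inE orbC.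
have -> : x == y = false by apply/eqP => E; rewrite E ltnn in xy.
case: p1 => [|z p1] //= S xs extreme H1.
move: xs; rewrite inE => /orP[/eqP//|xp].
have := @sorted_ord_cat [::] (p1 ++ [:: y]) z S => -[_ /(_ x)].
by rewrite mem_cat xp => /(_ isT); have := extreme z (mem_head _ _); lia.
Qed.

Lemma mem_cycle_edges (c : seq 'I_n) x : x \in c -> [set x; next c x] \in cycle_edges c.
Proof. by move=> xc; apply/imsetP; exists x. Qed.

Lemma cycle_edges_vertices (c : seq 'I_n) x :
  (x \in c) = [exists e in cycle_edges c, x \in e].
Proof.
apply/idP/exists_inP => [xc|[_ /imsetP[z zc ->]]].
  by exists [set x; next c x]; rewrite ?mem_cycle_edges ?set21.
by rewrite !inE => /orP[] /eqP ->; rewrite ?mem_next.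
Qed.

Lemma set2_eq (T : finType) (x y z w : T) : [set x; y] = [set z; w] ->
  (x = z /\ y = w) \/ (x = w /\ y = z).
Proof.
move=> /setP E; have := E x; have := E y; have := E z; have := E w.
rewrite !inE !eqxx !orbT /=.
by do 4![case: eqP => ? //=]; subst; auto; do ?[case: eqP => ? //=]; subst; auto.
Qed.

(** Two vertices with the same edge would be each other's successors, which three distinct vertices
    exclude. *)
Lemma card_cycle_edges (c : seq 'I_n) :
  uniq c -> 2 < size c -> #|cycle_edges c| = size c.
Proof.
move=> U sz; rewrite card_in_imset; first by apply/card_uniqP.
move=> x y xc yc /set2_eq [[]//|[xy yx]].
have [i q Eq] := rot_to xc.
have Uq : uniq (x :: q) by rewrite -Eq rot_uniq.
have szq : size (x :: q) = size c by rewrite -Eq size_rot.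
move: yx xy; rewrite -!(next_rot i U) Eq.
case: q Eq Uq szq => [|y' [|z q]] /=; try by move=> _ _ E; rewrite -E in sz.
move=> _ /andP[]; rewrite eqxx !inE !negb_or => /and3P[/negbTE xy' /negbTE xz _] _ _.
by move=> <-; rewrite eq_sym xy' eqxx => /eqP; rewrite xz.
Qed.

Lemma adj_sym T : symmetric (@adj n T).
Proof. by move=> x y; rewrite /adj /= setUC. Qed.

Definition noncrossing_rel (e : rel 'I_n) := forall x y z w : 'I_n,
  x < y -> z < w -> e x y -> e z w -> ~~ (x < z < y) || (w <= y).

(* If the cycle had vertices on both sides of its edge {x, y}, the path joining
   [y] to [x] would cross that edge. *)
Lemma cycle_edge_side (e : rel 'I_n) x y p : symmetric e -> noncrossing_rel e ->
  ucycle e [:: x, y & p] -> forall u v : 'I_n, u < v -> [set u; v] = [set x; y] ->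
  {in p, forall z : 'I_n, u < z < v} \/ {in p, forall z : 'I_n, ~~ (u < z < v)}.
Proof.
move=> e_sym e_nc /andP[/= /andP[xy yp] /andP[xyp /andP[yNp up]]] u v uv uvE.
have euv : e u v.
  by case: (set2_eq uvE) => [[-> ->]|[-> ->]] //; rewrite e_sym.
have ne z : z \in p -> (z != u) && (z != v).
  move=> zp; have: z \notin [set u; v].
    rewrite uvE !inE; apply/norP; split; apply: contraTneq zp => ->.
      by apply: contra xyp => xp; rewrite inE xp orbT.
    by [].
  by rewrite !inE negb_or.
pose P (z : 'I_n) := u < z < v.
have [inside|] := boolP (all P p); first by left => z /(allP inside).
have [outside|] := boolP (all (predC P) p); first by right => z /(allP outside).
rewrite -!has_predC => hasP hasN; exfalso.
have {}hasP : has P p by apply: sub_has hasP => z /=; rewrite negbK.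
case: p xyp yNp up yp ne hasP hasN => // z p xyp yNp up /andP[_ zp] ne hasP hasN.
have {}zp : path e z p.
  by have : path e z (rcons p x) := zp; rewrite rcons_path => /andP[].
have [a [b [ap bp ab Pa Pb]]] := path_change e_sym zp hasP hasN.
have := ne _ ap; have := ne _ bp; move: Pa Pb; rewrite /P /= => Pa Pb.
move=> /andP[/eqP bu /eqP bv] _.
have {}bu : b <> u :> nat by move=> E; apply: bu; apply: val_inj.
have {}bv : b <> v :> nat by move=> E; apply: bv; apply: val_inj.
have [vb|vb] := ltnP v b.
  by have := e_nc u v a b uv _ euv ab; lia.
by have := e_nc b a u v _ uv _ euv; rewrite e_sym => /(_ _ ab); lia.
Qed.

(** After a rotation bringing [x] to the front, [cycle_edge_side] applies. The two alternatives are
    the hypotheses of [next_sorted_extreme] and [next_sorted_between]. *)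
Lemma ucycle_next_side (e : rel 'I_n) c x (u v : 'I_n) :
  symmetric e -> noncrossing_rel e -> 2 < size c ->
  ucycle e c -> x \in c -> u < v -> [set u; v] = [set x; next c x] ->
  {in c, forall z : 'I_n, u <= z <= v} \/ {in c, forall z : 'I_n, ~~ (u < z < v)}.
Proof.
move=> e_sym e_nc sz /andP[cc Uc] xc uv; rewrite -(next_rot 0 Uc) rot0.
have [i q Eq] := rot_to xc; rewrite -(next_rot i Uc) Eq.
have memc z : (z \in c) = (z \in x :: q) by rewrite -Eq mem_rot.
have ucq : ucycle e (x :: q) by rewrite /ucycle -Eq rot_cycle rot_uniq cc.
have szq : size (x :: q) = size c by rewrite -Eq size_rot.
case: q ucq memc szq {Eq} => [|y p] ucq memc szq; first by rewrite -szq in sz.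
rewrite /= eqxx => uvE.
have in_uv z : (z == x) || (z == y) -> (z == u) || (z == v).
  by have /setP/(_ z) := uvE; rewrite !inE => ->.
have [H|H] := cycle_edge_side e_sym e_nc ucq uv uvE; [left | right] => z;
  rewrite memc !inE orbA => /orP[/in_uv/orP[]/eqP->|/H]; lia.
Qed.

(** By [ucycle_next_side] each edge of [c] joins neighbours or the two extremes of the sorted list,
    so it is an edge of [s]. Both edge sets have [size c] elements, so inclusion is equality. *)
Lemma cycle_edges_sort (e : rel 'I_n) c (s := sort (fun x y : 'I_n => x <= y) c) :
  symmetric e -> noncrossing_rel e -> 2 < size c -> ucycle e c ->
  sorted ord_lt s /\ cycle_edges c = cycle_edges s.
Proof.
move=> e_sym e_nc sz uc; have Uc : uniq c by case/andP: uc.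
have Us : uniq s by rewrite sort_uniq.
have ss : sorted ord_lt s.
  have : sorted leq (map val s).
    by rewrite -sort_map sort_sorted //; apply: leq_total.
  move=> H; have : sorted ltn (map val s).
    by rewrite ltn_sorted_uniq_leq H andbT map_inj_uniq; [apply: Us | apply: val_inj].
  by rewrite sorted_map.
split=> //; apply/eqP; rewrite eqEcard !card_cycle_edges ?size_sort // leqnn andbT.
apply/subsetP => _ /imsetP[x xc ->].
have ms z : (z \in s) = (z \in c) by rewrite mem_sort.
suff main (u v : 'I_n) : u < v -> [set u; v] = [set x; next c x] ->
    [set u; v] \in cycle_edges s.
  have [lt|lt|E] := ltngtP x (next c x); first exact: (main x (next c x)).
    by rewrite setUC; apply: main; rewrite // setUC.
  have E' : x = next c x by apply: val_inj.
  have [i q Eq] := rot_to xc; move: E'; rewrite -(next_rot i Uc).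
  have : uniq (x :: q) by rewrite -Eq rot_uniq.
  have szq : size (x :: q) = size c by rewrite -Eq size_rot.
  rewrite Eq; case: q szq {Eq} => [E1|y q] /=; first by rewrite -E1 in sz.
  by rewrite inE eqxx => _ /andP[/norP[/eqP]].
move=> uv uvE.
have uc' : u \in s.
  have /setP/(_ u) := uvE; rewrite set21 !inE ms => /esym/orP[]/eqP->//.
  by rewrite mem_next.
have vc' : v \in s.
  have /setP/(_ v) := uvE; rewrite set22 !inE ms => /esym/orP[]/eqP->//.
  by rewrite mem_next.
have [H|H] := ucycle_next_side e_sym e_nc sz uc xc uv uvE.
  rewrite setUC -{1}(@next_sorted_extreme s u v) ?mem_cycle_edges // => z.
  by rewrite ms => /H.
rewrite -{1}(@next_sorted_between s u v) ?mem_cycle_edges // => z.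
by rewrite ms => /H.
Qed.

Lemma sorted_cycle_edges_inj (s s' : seq 'I_n) :
  sorted ord_lt s -> sorted ord_lt s' -> cycle_edges s = cycle_edges s' -> s = s'.
Proof.
move=> ss ss' E; apply: (irr_sorted_eq ord_lt_trans) ss ss' _.
  by move=> x; apply: ltnn.
by move=> x; rewrite !cycle_edges_vertices E.
Qed.

End Polygon.

(** * Triangulations as trees *)

Lemma set2_ltn_inj n (x y z w : 'I_n) : x < y -> z < w ->
  [set x; y] = [set z; w] -> x = z /\ y = w.
Proof. by move=> xy zw /set2_eq[[-> ->]|[E1 E2]] //; subst; lia. Qed.

Lemma card2_ltn n (e : {set 'I_n}) : #|e| == 2 ->
  exists x y : 'I_n, x < y /\ e = [set x; y].
Proof.
case/cards2P => x [y [xy ->]].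
have [lt|lt|/val_inj E] := ltngtP x y; first by exists x, y.
  by exists y, x; rewrite setUC.
by rewrite E eqxx in xy.
Qed.

Section Triangulations.

Variables (m : nat) (m_gt1 : 1 < m).

Definition edge (p : nat * nat) : {set 'I_m.+1} := [set inord p.1; inord p.2].

Lemma edgeE (x y : 'I_m.+1) : edge (x : nat, y : nat) = [set x; y].
Proof. by rewrite /edge !inord_val. Qed.

Definition proper_pair (p : nat * nat) := p.1 < p.2 <= m.

Lemma edge_proper p : proper_pair p ->
  exists x y : 'I_m.+1, x < y /\ p = (x : nat, y : nat).
Proof.
case: p => a b /andP[/= ab bm].
have a1 : a < m.+1 by lia.
by exists (Ordinal a1), (Ordinal (bm : b < m.+1)).
Qed.

Lemma edge_inj : {in proper_pair &, injective edge}.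
Proof.
move=> p q /edge_proper[x [y [xy ->]]] /edge_proper[z [w [zw ->]]].
by rewrite !edgeE => /(set2_ltn_inj xy zw)[-> ->].
Qed.

(** The side from the last vertex back to the first is written increasingly, as [(0, m)]: it is the
    root edge. *)
Definition side_pairs := (0, m) :: [seq (i, i.+1) | i <- iota 0 m].

Lemma mem_side_pairs a b :
  ((a, b) \in side_pairs) = ((a == 0) && (b == m)) || ((a < m) && (b == a.+1)).
Proof.
rewrite inE xpair_eqE; congr (_ || _); apply/mapP/andP => [[i]|[am /eqP->]].
  by rewrite mem_iota /= => im [-> ->].
by exists a; rewrite ?mem_iota.
Qed.

Lemma side_pairs_proper p : p \in side_pairs -> proper_pair p.
Proof. by case: p => a b; rewrite mem_side_pairs /proper_pair /=; lia. Qed.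

Lemma uniq_side_pairs : uniq side_pairs.
Proof.
rewrite /= map_inj_uniq ?iota_uniq ?andbT; last by move=> ? ? [].
by apply/mapP => -[i]; rewrite mem_iota => im []; lia.
Qed.

Lemma ordS_val (i : 'I_m.+1) : ordS i = (if i == m :> nat then 0 else i.+1) :> nat.
Proof.
rewrite /=; case: eqP => [->|im]; first by rewrite modnn.
by rewrite modn_small //; have := ltn_ord i; lia.
Qed.

Lemma sidesE : sides m.+1 = [set:: map edge side_pairs].
Proof.
apply/setP => e; rewrite inE; apply/imsetP/mapP => [[i _ ->]|[[a b]]].
  have := ordS_val i; case: eqP => [im Si|im Si].
    exists (0, m); first exact: mem_head.
    have -> : (0, m) = (ordS i : nat, i : nat) by rewrite Si im.
    by rewrite edgeE setUC.
  exists (i : nat, i.+1); first by rewrite mem_side_pairs; have := ltn_ord i; lia.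
  have -> : (i : nat, i.+1) = (i : nat, ordS i : nat) by rewrite Si.
  by rewrite edgeE.
move=> abs ->; have := side_pairs_proper abs => /edge_proper[x [y [xy [ax by_]]]].
move: abs; rewrite mem_side_pairs ax by_ edgeE => /orP[/andP[/eqP x0 /eqP ym]|/andP[xm /eqP yx]].
  exists y => //; rewrite setUC; congr [set _; _]; apply: val_inj.
  by rewrite [RHS]ordS_val ym eqxx.
exists x => //; congr [set _; _]; apply: val_inj.
by rewrite [RHS]ordS_val /= yx; case: eqP => //; lia.
Qed.

Lemma card_sides : #|sides m.+1| = m.+1.
Proof.
rewrite sidesE cardsE; have /card_uniqP -> : uniq (map edge side_pairs).
  rewrite map_inj_in_uniq ?uniq_side_pairs // => p q /side_pairs_proper Hp /side_pairs_proper Hq.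
  exact: edge_inj.
by rewrite size_map /= size_map size_iota.
Qed.

Lemma mem_edges (s : seq (nat * nat)) (x y : 'I_m.+1) :
  {in s, forall p, proper_pair p} -> x < y ->
  ([set x; y] \in [set:: map edge s]) = ((x : nat, y : nat) \in s).
Proof.
move=> Hs xy; rewrite inE -edgeE; apply/mapP/idP => [[p ps E]|xys]; last by exists (x : nat, y : nat).
rewrite (edge_inj _ (Hs p ps) E) //.
by rewrite unfold_in /proper_pair /= xy -ltnS ltn_ord.
Qed.

Lemma chords_proper t : leaves t = m -> {in chords t 0, forall p, proper_pair p}.
Proof. by move=> tm [a b] /chords_bound; rewrite tm /proper_pair. Qed.

Definition tree_edges (t : tree) : {set {set 'I_m.+1}} := [set:: map edge (chords t 0)].

Lemma mem_tree_edges t (x y : 'I_m.+1) : leaves t = m -> x < y ->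
  ([set x; y] \in tree_edges t) = ((x : nat, y : nat) \in chords t 0).
Proof. by move=> /chords_proper; apply: mem_edges. Qed.

Lemma tree_edgesP t e : leaves t = m -> e \in tree_edges t ->
  exists x y : 'I_m.+1, [/\ x < y, e = [set x; y] & (x : nat, y : nat) \in chords t 0].
Proof.
move=> tm; rewrite inE => /mapP[p pt ->].
have [x [y [xy E]]] := edge_proper (chords_proper tm pt).
by exists x, y; rewrite -E; split=> //; rewrite E edgeE.
Qed.

Lemma card_tree_edges t : leaves t = m -> #|tree_edges t| = (2 * m).-1.
Proof.
move=> tm; rewrite cardsE; have /card_uniqP -> : uniq (map edge (chords t 0)).
  rewrite map_inj_in_uniq ?uniq_chords // => p q /(chords_proper tm) Hp /(chords_proper tm) Hq.
  exact: edge_inj.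
by rewrite size_map size_chords tm.
Qed.

Lemma sides_tree_edges t : leaves t = m -> sides m.+1 \subset tree_edges t.
Proof.
move=> tm; rewrite sidesE; apply/subsetP => e; rewrite inE => /mapP[p ps ->]; rewrite inE.
apply: map_f; move: ps; rewrite inE => /orP[/eqP->|/mapP[i]].
  by have := root_chords t 0; rewrite tm.
by rewrite mem_iota => im ->; apply: sides_chords; rewrite tm.
Qed.

Definition tree_diagonals (t : tree) := tree_edges t :\: sides m.+1.

Lemma sides_tree_diagonals t :
  leaves t = m -> sides m.+1 :|: tree_diagonals t = tree_edges t.
Proof.
move=> /sides_tree_edges/subsetP sub; apply/setP => e; rewrite in_setU in_setD.
by case: (boolP (e \in sides m.+1)) => [/sub ->|].
Qed.

Lemma tree_diagonals_inj : {in [pred t | leaves t == m] &, injective tree_diagonals}.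
Proof.
move=> t u /eqP tm /eqP um E.
have {}E : tree_edges t = tree_edges u by rewrite -!sides_tree_diagonals // E.
apply: (@chords_inj t u 0); first by rewrite tm.
move=> p; apply/idP/idP => Hp.
  have [x [y [xy Ep]]] := edge_proper (chords_proper tm Hp).
  by move: Hp; rewrite Ep -!mem_tree_edges // E.
have [x [y [xy Ep]]] := edge_proper (chords_proper um Hp).
by move: Hp; rewrite Ep -!mem_tree_edges // E.
Qed.

Lemma tree_diagonals_triangulation t :
  leaves t = m -> tree_diagonals t \in triangulations m.+1.
Proof.
move=> tm; rewrite inE; apply/and3P; split.
- apply/subsetP => e; rewrite inE => /andP[eS eT]; rewrite inE eS andbT.
  have [x [y [xy -> _]]] := tree_edgesP tm eT.
  by rewrite cards2 -val_eqE neq_ltn xy.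
(* Removing the m + 1 sides from the 2m - 1 edges leaves m - 2 diagonals, which is n - 3 for n = m +
   1. *)
- have := cardsID (sides m.+1) (tree_edges t).
  rewrite (setIidPr (sides_tree_edges tm)) card_sides card_tree_edges // -/(tree_diagonals t).
  by move=> H; apply/eqP; lia.
apply/forall_inP => e /setDP[eT _]; apply/forall_inP => f /setDP[fT _].
apply/negP => /existsP[a /existsP[c /existsP[b /existsP[d]]]].
move=> /and3P[/eqP ec /eqP fd]; rewrite {}ec {}fd in eT fT *.
move=> /andP[/andP[ab bc] dac].
have ac : a < c by lia.
move: eT; rewrite mem_tree_edges // => acT.
(* [crossing] leaves the order of [b] and [d] open: either [b] lies under the chord ac and [d]
   beyond it, or [a] lies under the chord db and [c] beyond it. *)
have [bd|bd] := ltnP b d.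
  move: fT; rewrite mem_tree_edges // => bdT.
  by have := chords_noncrossing acT bdT; lia.
have db : d < b by lia.
move: fT; rewrite setUC mem_tree_edges // => bdT.
by have := chords_noncrossing bdT acT; lia.
Qed.

(** Listed as increasing pairs, the sides and diagonals number (m + 1) + (m - 2) = 2m - 1. This
    attains the bound of [noncrossing_max], which then provides the tree. *)
Lemma triangulation_tree_diagonals T : T \in triangulations m.+1 ->
  exists2 t, leaves t = m & T = tree_diagonals t.
Proof.
rewrite inE => /and3P[/subsetP TD /eqP cT /forall_inP nc].
pose pairs := [seq (x, y) | x <- iota 0 m.+1, y <- iota 0 m.+1].
pose F := [seq p <- pairs | proper_pair p && (edge p \in sides m.+1 :|: T)].
have memF p : (p \in F) = proper_pair p && (edge p \in sides m.+1 :|: T).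
  rewrite mem_filter andb_idr // => /andP[].
  case: p => x y; rewrite /proper_pair /= => xy _.
  by apply: allpairs_f; rewrite mem_iota; lia.
have uF : uniq F.
  rewrite filter_uniq // allpairs_uniq ?iota_uniq //.
  by move=> [x y] [z w] _ _ [-> ->].
have EF : sides m.+1 :|: T = [set:: map edge F].
  apply/setP => e; rewrite [RHS]inE; apply/idP/mapP => [eST|[p]]; last first.
    by rewrite memF => /andP[_ H] ->.
  have [x [y [xy Ee]]] : exists x y : 'I_m.+1, x < y /\ e = [set x; y].
    move: (eST); rewrite inE sidesE => /orP[|/TD]; last first.
      by rewrite inE => /andP[/card2_ltn].
    rewrite inE => /mapP[p /side_pairs_proper/edge_proper[x [y [xy ->]]] ->].
    by exists x, y; rewrite edgeE.
  exists (x : nat, y : nat); last by rewrite edgeE.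
  by rewrite memF edgeE -Ee eST /proper_pair /= xy -ltnS ltn_ord.
have disj : [disjoint sides m.+1 & T].
  rewrite disjoint_sym; apply/pred0P => e /=; apply/negbTE/negP => /andP[/TD].
  by rewrite inE => /andP[_ /negP].
have szF : size F = (2 * m).-1.
  have : #|sides m.+1 :|: T| = size F.
    rewrite EF cardsE; have /card_uniqP -> : uniq (map edge F); last by rewrite size_map.
    rewrite map_inj_in_uniq // => p q; rewrite !memF => /andP[Hp _] /andP[Hq _].
    exact: edge_inj.
  by rewrite cardsU disjoint_setI0 // cards0 card_sides cT; lia.
have sF p : p \in side_pairs -> p \in F.
  move=> ps; rewrite memF side_pairs_proper //= inE sidesE inE.
  by rewrite map_f.
have [|||||_ tF] := @noncrossing_max m 0 F _ uF.
- lia.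
- by move=> x y; rewrite memF => /andP[].
- exact/sF/mem_head.
- by move=> i im; apply: sF; rewrite mem_side_pairs; lia.
- move=> x y z w xyF zwF; apply/negPn/negP.
  rewrite negb_or negbK -ltnNge => /andP[/andP[xz zy] yw].
  (* Of two crossing pairs neither is a side, so both come from [T], where crossings are
     excluded. *)
  have no_side p : p \in F -> edge p \in sides m.+1 -> p \in side_pairs.
    rewrite sidesE inE memF => /andP[Hp _] /mapP[s ss E].
    by rewrite (edge_inj Hp (side_pairs_proper ss) E).
  have xyT : edge (x, y) \in T.
    have := xyF; rewrite memF inE => /andP[_ /orP[|//]].
    move=> /(no_side _ xyF); rewrite mem_side_pairs.
    by move: zwF; rewrite memF => /andP[]; rewrite /proper_pair /=; lia.
  have zwT : edge (z, w) \in T.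
    have := zwF; rewrite memF inE => /andP[_ /orP[|//]].
    move=> /(no_side _ zwF); rewrite mem_side_pairs.
    by move: zwF; rewrite memF => /andP[]; rewrite /proper_pair /=; lia.
  move: xyF zwF; rewrite !memF => /andP[/edge_proper[x' [y' [_ [Ex Ey]]]] _].
  move=> /andP[/edge_proper[z' [w' [_ [Ez Ew]]]] _].
  have /forall_inP/(_ _ zwT)/negP := nc _ xyT; apply.
  apply/existsP; exists x'; apply/existsP; exists y'.
  apply/existsP; exists z'; apply/existsP; exists w'.
  by rewrite Ex Ey Ez Ew !edgeE !eqxx /=; lia.
have [t tm Et] := tF szF; exists t => //.
have -> : T = (sides m.+1 :|: T) :\: sides m.+1.
  rewrite setDUl setDv set0U; apply/esym/setDidPl; rewrite disjoint_sym.
  exact: disj.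
congr (_ :\: _); rewrite EF; apply/setP => e; rewrite !inE.
by apply: eq_mem_map.
Qed.

(** * Summation over triangulations and count of their cycles *)

Lemma sum_triangulations (V : nmodType) (f : {set {set 'I_m.+1}} -> V) :
  (\sum_(T in triangulations m.+1) f T = \sum_(t <- trees m) f (tree_diagonals t))%R.
Proof.
rewrite -big_enum /= -[RHS](big_map tree_diagonals xpredT f).
apply: perm_big; apply: uniq_perm; first exact: enum_uniq.
  rewrite map_inj_in_uniq ?uniq_trees // => t u; rewrite !mem_trees.
  exact: tree_diagonals_inj.
move=> T; rewrite mem_enum; apply/idP/mapP => [/triangulation_tree_diagonals[t tm ->]|[t]].
  by exists t; rewrite // mem_trees tm.
by rewrite mem_trees => /eqP tm ->; apply: tree_diagonals_triangulation.
Qed.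

Lemma tree_adjE t (x y : 'I_m.+1) : leaves t = m -> x < y ->
  adj (tree_diagonals t) x y = ((x : nat, y : nat) \in chords t 0).
Proof. by move=> tm xy; rewrite /adj /= sides_tree_diagonals // mem_tree_edges. Qed.

Lemma tree_adj_noncrossing t :
  leaves t = m -> noncrossing_rel (adj (tree_diagonals t)).
Proof. by move=> tm x y z w xy zw; rewrite !tree_adjE //; apply: chords_noncrossing. Qed.

(** Along an increasing list [chord_rel] and [adj] agree; only the closing edge is traversed
    downwards, and symmetry turns it round. *)
Lemma tree_ucycle t (s : seq 'I_m.+1) : leaves t = m -> sorted (@ord_lt m.+1) s ->
  (map val s \in chord_cycles t 0) = ucycleb (adj (tree_diagonals t)) s && (2 < size s).
Proof.
move=> tm ss; have us := sorted_ord_uniq ss.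
case: s ss us => [|x p] ss us; first by rewrite (negbTE (nil_chord_cycles t 0)).
rewrite /ucycleb us andbT map_cons mem_chord_cycles size_map /= rcons_path.
rewrite ltnS [RHS]andbC; have [sz|//] /= := ltnP 1 (size p).
have -> : path (chord_rel t 0) x (map val p) = path (adj (tree_diagonals t)) x p.
  rewrite path_map; elim: p x ss {us sz} => //= y p IH x /andP[xy yp].
  by rewrite IH // tree_adjE.
rewrite last_map adj_sym tree_adjE //; have [_] := @sorted_ord_cat _ [::] p x ss.
by apply; case: p sz {ss us} => //= y p _; apply: mem_last.
Qed.

Lemma cycle_adjE (T : {set {set 'I_m.+1}}) c : uniq c ->
  cycle (adj T) c = (cycle_edges c \subset sides m.+1 :|: T).
Proof.
move=> uc; apply/idP/subsetP => [cc _ /imsetP[x xc ->]|sub].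
  exact: (next_cycle cc xc).
by apply: cycle_from_next => // x xc; apply: sub; apply: mem_cycle_edges.
Qed.

Lemma chord_cycles_vals t s : leaves t = m -> s \in chord_cycles t 0 ->
  map val (map inord s : seq 'I_m.+1) = s /\
  sorted (@ord_lt m.+1) (map inord s).
Proof.
move=> tm; case: s => [|x p]; first by rewrite (negbTE (nil_chord_cycles t 0)).
rewrite mem_chord_cycles => /and3P[szp xp _].
have le_m : all (fun y => y < m.+1) (x :: p).
  have: path (fun y z => (y < m.+1) && (z < m.+1)) x p.
    by apply: sub_path xp => y z /chords_bound; rewrite tm; lia.
  case: p szp {xp} => // y p _ /= /andP[/andP[-> ->]] /=.
  by elim: p y => //= z p IH y /andP[/andP[_ ->] /IH].
have K : map val (map inord (x :: p) : seq 'I_m.+1) = x :: p.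
  by rewrite -map_comp map_id_in // => z /(allP le_m) zm; apply: inordK.
split=> //; have := chord_path_sorted xp.
by rewrite -{1}K sorted_map.
Qed.

(** Taking edge sets is a bijection from increasing traversals to cycles: injective by
    [sorted_cycle_edges_inj], surjective by [cycle_edges_sort]. *)
Lemma card_tree_cycles t k : leaves t = m -> 2 < k ->
  #|cycles (tree_diagonals t) k| = count (fun s => size s == k) (chord_cycles t 0).
Proof.
move=> tm k3; pose L := [seq s <- chord_cycles t 0 | size s == k].
pose f (s : seq nat) := cycle_edges (map inord s : seq 'I_m.+1).
rewrite -size_filter -/L -(size_map f).
have LP s : s \in L -> [/\ map val (map inord s : seq 'I_m.+1) = s,
    sorted (@ord_lt m.+1) (map inord s), s \in chord_cycles t 0 & size s == k].
  rewrite mem_filter => /andP[sk st].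
  by have [] := chord_cycles_vals tm st.
have /card_uniqP <- : uniq (map f L).
  rewrite map_inj_in_uniq ?filter_uniq ?uniq_chord_cycles //.
  move=> s s' /LP[Ks ss _ _] /LP[Ks' ss' _ _] E.
  by rewrite -Ks -Ks' (sorted_cycle_edges_inj ss ss' E).
apply: eq_card => E; apply/imsetP/mapP => [[c]|[s /LP[Ks ss sc sk] ->]]; last first.
  have sk' : size (map inord s : seq 'I_m.+1) == k by rewrite size_map.
  exists (Tuple sk') => //; rewrite inE /=.
  by move: sc; rewrite -{1}Ks tree_ucycle // => /andP[].
rewrite inE => uc ->; have szc : 2 < size c by rewrite size_tuple.
have [ss Ec] := cycle_edges_sort (@adj_sym _ _) (tree_adj_noncrossing tm) szc uc.
set s := sort _ c in ss Ec; have us := sorted_ord_uniq ss.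
exists (map val s); last by rewrite /f mapK ?Ec //; apply: inord_val.
rewrite mem_filter size_map size_sort size_tuple eqxx tree_ucycle //.
rewrite size_sort szc andbT /ucycleb us andbT cycle_adjE // -Ec.
by move: uc => /andP[cc uc]; rewrite -cycle_adjE.
Qed.

End Triangulations.

Local Open Scope ring_scope.

Theorem corollary7 (n k : nat) (hk : (3 <= k)%N) (hkn : (k < n)%N) :
  average_cycles n k =
  'C(2 * n - k - 1, n - 1)%:R * (catalan (k - 2) / catalan (n - 2)).
Proof.
(* A tree with [j] leaves triangulates a polygon with [j + 1] vertices, hence the Catalan index
   [j - 1]. *)
have ntreesC j : (0 < j)%N -> ntrees j = catalan (j - 1).
  by case: j => // j _; rewrite ntrees_catalan subn1.
case: n hkn => // m hkm; have m_gt1 : (1 < m)%N by lia.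
rewrite /average_cycles sum_triangulations //.
(* The denominator is the sum of the constant 1 over the triangulations, carried over to trees. *)
have -> : #|triangulations m.+1|%:R = catalan (m.+1 - 2).
  rewrite -sum1_card natr_sum sum_triangulations //.
  by rewrite -ntreesE ntreesC; [congr catalan | ]; lia.
have -> : \sum_(t <- trees m) #|cycles (tree_diagonals m t) k|%:R = ncycles m k.
  rewrite /ncycles big_seq [RHS]big_seq; apply: eq_bigr => t.
  rewrite mem_trees => /eqP tm.
  by rewrite card_tree_cycles // (coef_cycle_poly t 0).
rewrite ncyclesE; last by lia.
rewrite ntreesC; last by lia.
have -> : (k.-1 - 1 = k - 2)%N by lia.
have -> : (2 * m.+1 - k - 1 = 2 * m - k.-1)%N by lia.
by rewrite subn1 mulrAC mulrC mulrA.
Qed.
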